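(* If $D\in D(1,1)$ is a connected digraph with $m$ edges, and $D$ is not a directed triangle, then $D$ contains a directed cut of size at least $7m/20$.
   Context: All digraphs are finite, without loops and without parallel edges; connected means the underlying undirected graph is connected. For integers $k,\ell\ge 0$, $D(k,\ell)$ denotes the family of digraphs in which every vertex $v$ satisfies $d^-(v)\le k$ or $d^+(v)\le \ell$. A directed cut of a digraph $D$ is a set of edges of the form $\{xy\in E(D): x\in X, y\in Y\}$ for some partition $X,Y$ of $V(D)$; its size is its cardinality. A directed triangle is a directed cycle of length 3. *)

(* Defs.v *)
From mathcomp Require Import all_boot.

Set Implicit Arguments.
Unset Strict Implicit.
Unset Printing Implicit Defensive.

Section Digraph.

Variables (V : finType) (e : rel V).

(* A digraph is a finite vertex type V with an irreflexive relation e.  There is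
   at most one edge from x to y; both xy and yx may be edges. *)

Definition edges : {set V * V} := [set p | e p.1 p.2].

Definition indeg (v : V) : nat := #|[set u | e u v]|.

Definition outdeg (v : V) : nat := #|[set u | e v u]|.

Definition in_D (k l : nat) : Prop :=
  forall v : V, indeg v <= k \/ outdeg v <= l.

Definition connected_digraph : Prop :=
  forall x y : V, connect [rel u v | e u v || e v u] x y.

Definition cut_edges (X Y : {set V}) : {set V * V} :=
  [set p in edges | (p.1 \in X) && (p.2 \in Y)].

(* One of X and Y may be empty, in which case the cut is empty. *)
Definition directed_cut (F : {set V * V}) : Prop :=
  exists X Y : {set V},
    [/\ [disjoint X & Y], X :|: Y = [set: V] & F = cut_edges X Y].

(* The whole digraph is a directed cycle of length 3: there are no further
   vertices and no further edges. *)
Definition directed_triangle : Prop :=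
  exists x y z : V,
    [/\ uniq [:: x; y; z],
        [set: V] = [set x; y; z] &
        edges = [set (x, y); (y, z); (z, x)]].

End Digraph.

(* Main.v *)
Require Import Defs.
From mathcomp Require Import all_boot all_order all_algebra zify.

(** A directed cut contains the same edges as an independent set of the line graph,
    in which two edges are adjacent when they form a directed path of length 2.
    Orient each adjacency at a vertex v from the leaves of the star to its centre:
    the centre is the unique edge entering v if v has indegree at most 1, and the
    unique edge leaving v otherwise.  Let P be the set of edges from vertices of
    indegree at most 1 to vertices of larger indegree.  Members of P have at most
    two arcs and no further neighbours, all other edges have at most one arc, so
    there are at most m + |P| arcs; and P is independent.  Arcs starting in a
    triangle of the line graph end in it.

    For such oriented graphs without a triangle component, with n vertices and
    k arcs, some independent set I satisfies 19 |I| >= 8 n - k.  Hence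
    19 |I| >= 7 m - |P|, and the larger of I and P has at least 7 m / 20 elements.

    The inequality is proved by deleting small sets of vertices.  The only
    operation that loses is the removal of a triangle attached by a single edge;
    the loss is recorded as a star on the vertex it was attached to, which adds 1
    to the left-hand weight and takes the place of the arc that was lost.  In a
    minimal counterexample all degrees are at least 2, no triangle has a vertex of
    degree 2, and every vertex has at most one neighbour of degree 2; counting the
    arcs between the vertices of degree at least 3 then gives a contradiction. *)

Set Implicit Arguments.
Unset Strict Implicit.
Unset Printing Implicit Defensive.

(** * Induced subgraphs, degrees and arc counts *)

Section ArcGraph.

Context (T : finType) (a : rel T).

Implicit Types (S I J : {set T}) (x y z u v w : T) (st : T -> nat).

Definition adj x y := a x y || a y x.

Definition nbr (S : {set T}) x := [set y in S | adj x y].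

Definition succs (S : {set T}) x := [set y in S | a x y].

Definition narcs (S : {set T}) := \sum_(x in S) #|succs S x|.

Definition indep (I : {set T}) := {in I &, forall x y, ~~ adj x y}.

Definition triangle x y z := [&& adj x y, adj y z & adj x z].

Definition weight (st : T -> nat) (S : {set T}) := 8 * #|S| + \sum_(x in S) st x.

Definition bounded (S : {set T}) st :=
  exists I : {set T},
    [/\ I \subset S, indep I & weight st S <= 19 * #|I| + narcs S].

(* [st x] counts the pendant triangles already removed at [x]. *)
Record admissible (S : {set T}) (st : T -> nat) : Prop := Admissible {
  adm_cap : forall x, x \in S ->
    #|succs S x| + st x <= 1 \/ #|nbr S x| + st x <= 2;
  adm_star : forall x y z, x \in S -> y \in S -> z \in S ->
    triangle x y z -> st x = 0;
  adm_comp : forall x y z, x \in S -> y \in S -> z \in S ->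
    triangle x y z -> 6 < #|nbr S x| + #|nbr S y| + #|nbr S z|
}.

Lemma adjC x y : adj x y = adj y x.
Proof. by rewrite /adj orbC. Qed.

Lemma in_nbr S x y : (y \in nbr S x) = (y \in S) && adj x y.
Proof. by rewrite inE. Qed.

Lemma nbr_sub S S' x : S' \subset S -> nbr S' x \subset nbr S x.
Proof.
move=> sS; apply/subsetP=> y; rewrite !in_nbr => /andP[yS ->].
by rewrite (subsetP sS).
Qed.

Lemma succs_sub S S' x : S' \subset S -> succs S' x \subset succs S x.
Proof.
move=> sS; apply/subsetP=> y; rewrite !inE => /andP[yS ->].
by rewrite (subsetP sS).
Qed.

Lemma narcs_sub S S' : S' \subset S -> narcs S' <= narcs S.
Proof.
move=> sS; rewrite /narcs [leqRHS](big_setID S') /= (setIidPr sS).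
apply: leq_trans (leq_addr _ _); apply: leq_sum => x _.
exact: subset_leq_card (succs_sub x sS).
Qed.

Lemma sum_preds S x : \sum_(y in S) a y x = #|[set y in S | a y x]|.
Proof.
rewrite -sum1_card big_mkcond [RHS]big_mkcond /=.
by apply: eq_bigr => y _; rewrite !inE; case: (y \in S).
Qed.

Lemma card_nbr_le S x : #|nbr S x| <= #|succs S x| + #|[set y in S | a y x]|.
Proof.
apply: leq_trans (leq_card_setU _ _).1.
by apply: subset_leq_card; apply/subsetP=> y; rewrite !inE /adj andb_orr.
Qed.

(** Each neighbour of [x] accounts for a lost arc; equality can fail because a pair of opposite arcs
    gives only one neighbour. *)
Lemma narcs_del S x : x \in S -> narcs (S :\ x) + #|nbr S x| <= narcs S.
Proof.
move=> xS; rewrite /narcs (big_setD1 x xS) /=.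
have -> : \sum_(y in S :\ x) #|succs S y|
    = \sum_(y in S :\ x) #|succs (S :\ x) y| + \sum_(y in S :\ x) a y x.
  rewrite -big_split /=; apply: eq_bigr => y _.
  rewrite (cardsD1 x (succs S y)) inE xS addnC; congr (_ + _).
  by apply: eq_card => z; rewrite !inE andbA.
rewrite sum_preds addnCA leq_add2l.
apply: leq_trans (leq_card_setU _ _).1.
apply: subset_leq_card; apply/subsetP=> y; rewrite !inE /adj.
case: eqP => [->|_] /=; first by rewrite orbb => /andP[-> ->].
by rewrite andb_orr.
Qed.

Lemma nbr_del S x y : x \in S -> #|nbr S y| = #|nbr (S :\ x) y| + adj y x.
Proof.
move=> xS; rewrite (cardsD1 x (nbr S y)) in_nbr xS addnC; congr (_ + _).
by apply: eq_card => z; rewrite !inE andbA.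
Qed.

Lemma weight_del st S x : x \in S -> weight st S = weight st (S :\ x) + 8 + st x.
Proof. by move=> xS; rewrite /weight (cardsD1 x S) xS (big_setD1 x xS) /=; lia. Qed.

(** The common form of all deletions: [J] joins an independent set of [S']. The cost is 8 per
    deleted vertex plus its stars, paid by 19 per member of [J] and 1 per lost arc. *)
Lemma bounded_step S S' st st' J :
    S' \subset S -> J \subset S -> indep J ->
    (forall x y, x \in J -> y \in S' -> ~~ adj x y) -> [disjoint J & S'] ->
    bounded S' st' ->
    weight st S + narcs S' <= weight st' S' + narcs S + 19 * #|J| ->
  bounded S st.
Proof.
move=> sS JS Ji JS' dJ [I [IS Ii bI]] le; exists (J :|: I); split.
- by rewrite subUset JS (subset_trans IS).
- move=> x y; rewrite !inE => /orP[xJ|xI] /orP[yJ|yI].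
  + exact: Ji.
  + exact: JS' (subsetP IS _ yI).
  + by rewrite adjC; exact: JS' (subsetP IS _ xI).
  + exact: Ii.
- suff : #|J :|: I| = #|J| + #|I| by lia.
  apply/eqP; rewrite (leq_card_setU J I).2; exact: disjointWr IS dJ.
Qed.

Lemma card_nbr_ge2 S x y z : y \in S -> z \in S -> y != z ->
  adj x y -> adj x z -> 1 < #|nbr S x|.
Proof.
move=> yS zS yz xy xz; have <- : #|[set y; z]| = 2 by rewrite cards2 yz.
apply: subset_leq_card; apply/subsetP => t; rewrite !inE.
by case/orP=> /eqP ->; rewrite ?yS ?zS ?xy ?xz.
Qed.

Lemma card_nbr_ge3 S x y z v : y \in S -> z \in S -> v \in S ->
  y != z -> y != v -> z != v -> adj x y -> adj x z -> adj x v -> 2 < #|nbr S x|.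
Proof.
move=> yS zS vS yz yv zv xy xz xv.
rewrite -(_ : #|v |: [set y; z]| = 3).
  apply: subset_leq_card; apply/subsetP => t; rewrite !inE.
  by case/or3P=> /eqP ->; rewrite ?yS ?zS ?vS ?xy ?xz ?xv.
by rewrite cardsU1 cards2 yz !inE !(eq_sym v) (negbTE yv) (negbTE zv).
Qed.

Lemma card_nbr_gt2P S x y z : 2 < #|nbr S x| ->
  exists u, [/\ u \in S, adj x u, u != y & u != z].
Proof.
move=> lt; have : 0 < #|nbr S x :\: [set y; z]|.
  rewrite cardsD; have := subset_leq_card (subsetIr (nbr S x) [set y; z]).
  by rewrite cards2; lia.
case/card_gt0P=> u; rewrite !inE negb_or => /andP[/andP[uy uz] /andP[uS xu]].
by exists u.
Qed.

Lemma nbr2P S x : #|nbr S x| = 2 -> exists u w,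
  [/\ u != w, u \in S & w \in S] /\
  [/\ adj x u, adj x w & forall y, y \in S -> adj x y -> (y == u) || (y == w)].
Proof.
move/eqP/cards2P=> [u [w [uw E]]]; exists u, w.
have [] : u \in nbr S x /\ w \in nbr S x by rewrite E !inE !eqxx orbT.
rewrite !in_nbr => /andP[uS xu] /andP[wS xw]; split; split=> // y yS xy.
have : y \in nbr S x by rewrite in_nbr yS.
by rewrite E !inE.
Qed.

Lemma nbr2_other S x u : #|nbr S x| = 2 -> u \in S -> adj x u -> exists w,
  [/\ u != w, w \in S, adj x w
    & forall y, y \in S -> adj x y -> (y == u) || (y == w)].
Proof.
move=> /nbr2P[u' [w [[uw u'S wS] [xu' xw N]]]] uS xu.
case/orP: (N u uS xu) => /eqP E; subst u; first by exists w.
by exists u'; split; rewrite 1?eq_sym // => y yS xy; rewrite orbC N.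
Qed.

(** * Orientation near triangles, capacities and inherited admissibility *)

Hypothesis a_irr : irreflexive a.
Hypothesis triangle_closed :
  forall x y z w, triangle x y z -> a x w -> (w == y) || (w == z).

Lemma adj_irr x : adj x x = false.
Proof. by rewrite /adj a_irr. Qed.

Lemma adj_neq x y : adj x y -> x != y.
Proof. by apply: contraTneq => ->; rewrite adj_irr. Qed.

Lemma triangleC x y z : triangle x y z = triangle y x z.
Proof. by rewrite /triangle (adjC y x); congr (_ && _); rewrite andbC. Qed.

Lemma triangleAC x y z : triangle x y z = triangle x z y.
Proof. by rewrite /triangle (adjC z y); case: (adj x y); rewrite ?andbF //= andbT andbC. Qed.

(** Arcs starting in a triangle stay in it, so an adjacency with an outside vertex points to the
    triangle. *)
Lemma triangle_in x y z u : triangle x y z -> adj x u -> u != y -> u != z -> a u x.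
Proof.
move=> t /orP[xu|//] uy uz.
by move: (triangle_closed t xu); rewrite (negbTE uy) (negbTE uz).
Qed.

Lemma indep1 x : indep [set x].
Proof. by move=> y z /set1P -> /set1P ->; rewrite adj_irr. Qed.


Lemma succs_ge1 S x y : y \in S -> a x y -> 0 < #|succs S x|.
Proof. by move=> yS xy; apply/card_gt0P; exists y; rewrite inE yS. Qed.

Lemma succs_ge2 S x y z : y \in S -> z \in S -> y != z -> a x y -> a x z ->
  1 < #|succs S x|.
Proof.
move=> yS zS yz xy xz; have <- : #|[set y; z]| = 2 by rewrite cards2 yz.
apply: subset_leq_card; apply/subsetP => t; rewrite !inE.
by case/orP=> /eqP ->; rewrite ?yS ?zS ?xy ?xz.
Qed.

(** Otherwise [x] has outdegree at least 2 and, with [v], degree at least 3, against both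
    alternatives of [adm_cap]. *)
Lemma arc_unique S st x v y z : admissible S st ->
    x \in S -> v \in S -> adj x v -> y \in S -> z \in S ->
    v != y -> v != z -> a x y -> a x z ->
  y = z.
Proof.
move=> A xS vS xv yS zS vy vz xy xz; apply/eqP/negPn/negP => yz.
have := succs_ge2 yS zS yz xy xz.
have := card_nbr_ge3 vS yS zS vy vz yz xv.
rewrite /adj xy xz => /(_ isT isT).
by case: (adm_cap A xS); clear; lia.
Qed.

Lemma star_sink S st x y : admissible S st -> x \in S -> 1 < #|nbr S x| ->
  y \in S -> a x y -> st x = 0.
Proof.
move=> A xS dx yS xy; move: dx (succs_ge1 yS xy).
by case: (adm_cap A xS); clear; lia.
Qed.

Lemma star_le1 S st x : admissible S st -> x \in S -> 0 < #|nbr S x| -> st x <= 1.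
Proof. by move=> A xS dx; case: (adm_cap A xS); lia. Qed.

Lemma star_adj S st x y : admissible S st -> x \in S -> y \in S -> adj x y ->
  1 < #|nbr S x| -> 1 < #|nbr S y| -> st x + st y <= 1.
Proof.
move=> A xS yS xy dx dy.
have sx : st x <= 1 by apply: star_le1 A xS _; lia.
have sy : st y <= 1 by apply: star_le1 A yS _; lia.
case/orP: (xy) => h; first by rewrite (star_sink A xS dx yS h).
by rewrite (star_sink A yS dy xS h) addn0.
Qed.

Lemma triangle_nbr S x y z : y \in S -> z \in S -> triangle x y z ->
  #|nbr S x| <= 2 -> nbr S x = [set y; z].
Proof.
move=> yS zS /and3P[xy yz xz] dx; apply/esym/eqP.
rewrite eqEcard cards2 (adj_neq yz) dx andbT.
by apply/subsetP=> t; rewrite !inE => /orP[] /eqP ->; rewrite ?yS ?zS ?xy ?xz.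
Qed.

Lemma triangle_deg S x y z : y \in S -> z \in S -> triangle x y z ->
  1 < #|nbr S x|.
Proof.
by move=> yS zS /and3P[xy yz xz]; apply: card_nbr_ge2 yS zS (adj_neq yz) xy xz.
Qed.

(** Only a new triangle component can violate admissibility. Degrees inside a triangle are at least
    2, so a degree sum of at most 6 makes all three equal to 2. *)
Lemma admissible_sub S S' st : S' \subset S -> admissible S st ->
    (forall x y z, x \in S' -> y \in S' -> z \in S' -> triangle x y z ->
      nbr S' x = [set y; z] -> nbr S' y = [set x; z] -> nbr S' z = [set x; y] ->
      False) ->
  admissible S' st.
Proof.
move=> sS A H; split.
- move=> x xS; case: (adm_cap A (subsetP sS _ xS)) => h; [left|right].
    by apply: leq_trans h; rewrite leq_add2r; exact: subset_leq_card (succs_sub _ _).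
  by apply: leq_trans h; rewrite leq_add2r; exact: subset_leq_card (nbr_sub _ _).
- move=> x y z xS yS zS.
  by apply: (adm_star A); apply: (subsetP sS).
- move=> x y z xS yS zS t; rewrite ltnNge; apply/negP => le.
  have ty : triangle y x z by rewrite -triangleC.
  have tz : triangle z x y by rewrite triangleC triangleAC.
  have dx := triangle_deg yS zS t; have dy := triangle_deg xS zS ty.
  have dz := triangle_deg xS yS tz.
  have [lx ly lz] : [/\ #|nbr S' x| <= 2, #|nbr S' y| <= 2 & #|nbr S' z| <= 2].
    by move: le dx dy dz; clear; split; lia.
  by apply: (H x y z xS yS zS t); apply: triangle_nbr.
Qed.

Definition no_deg2_triangle S := forall x y z,
  x \in S -> y \in S -> z \in S -> triangle x y z -> 2 < #|nbr S x|.

(** In [S] the vertex [x] has a third neighbour; it was deleted, and its arc must point to [x] by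
    [triangle_in]. *)
Lemma isolated_triangle_pred S S' x y z : S' \subset S -> no_deg2_triangle S ->
    x \in S' -> y \in S' -> z \in S' -> triangle x y z -> nbr S' x = [set y; z] ->
  exists2 u, u \in S :\: S' & a u x.
Proof.
move=> sS N xS yS zS t E.
have /(card_gt0P)[u] : 0 < #|nbr S x :\: nbr S' x|.
  have := N _ _ _ (subsetP sS _ xS) (subsetP sS _ yS) (subsetP sS _ zS) t.
  rewrite cardsD; have := subset_leq_card (subsetIr (nbr S x) (nbr S' x)).
  rewrite {2}E cards2; lia.
rewrite !inE negb_and => /andP[h /andP[uS xu]].
move: h; rewrite xu orbF => uS'; exists u; rewrite ?inE ?uS' //.
by apply: (triangle_in t xu); apply: contraNneq uS' => ->.
Qed.

(* A triangle component created by a deletion receives an arc from the deleted set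
   at each of its three vertices. *)
Lemma admissible_del S S' st : S' \subset S -> no_deg2_triangle S ->
    admissible S st ->
    (forall x y z ux uy uz, x \in S' -> y \in S' -> z \in S' ->
      x != y -> y != z -> x != z ->
      ux \in S :\: S' -> uy \in S :\: S' -> uz \in S :\: S' ->
      a ux x -> a uy y -> a uz z -> False) ->
  admissible S' st.
Proof.
move=> sS N A H; apply: (admissible_sub sS A) => x y z xS yS zS t ex ey ez.
have ty : triangle y x z by rewrite -triangleC.
have tz : triangle z x y by rewrite triangleC triangleAC.
have [ux uxS ax] := isolated_triangle_pred sS N xS yS zS t ex.
have [uy uyS ay] := isolated_triangle_pred sS N yS xS zS ty ey.
have [uz uzS az] := isolated_triangle_pred sS N zS xS yS tz ez.
case/and3P: t => /adj_neq xy /adj_neq yz /adj_neq xz.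
exact: (H x y z ux uy uz).
Qed.

(** * Removing a pendant triangle *)

Section Step.

Context (S : {set T}) (st : T -> nat).

Hypothesis A : admissible S st.
Hypothesis IH : forall S' st', #|S'| < #|S| -> admissible S' st' -> bounded S' st'.

(** Three vertices cost 24; keeping [x] pays 19, and at least four arcs are lost: three at [y] and
    one between [x] and [z]. The missing 1 is the star put on the third neighbour of [y]. *)
Lemma pendant_triangle_step x y z : x \in S -> y \in S -> z \in S ->
    triangle x y z -> #|nbr S x| = 2 -> #|nbr S z| = 2 -> #|nbr S y| = 3 ->
  bounded S st.
Proof.
move=> xS yS zS t dx dz dy; case/and3P: (t) => xy yz xz.
have ty : triangle y x z by rewrite -triangleC.
have tz : triangle z x y by rewrite triangleC triangleAC.
have sx := adm_star A xS yS zS t; have sy := adm_star A yS xS zS ty.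
have sz := adm_star A zS xS yS tz.
have xney := adj_neq xy; have ynez := adj_neq yz; have xnez := adj_neq xz.
have nx := triangle_nbr yS zS t (eq_leq dx).
have nz := triangle_nbr xS yS tz (eq_leq dz).
have [u [uS yu ux uz]] : exists u, [/\ u \in S, adj y u, u != x & u != z].
  by apply: card_nbr_gt2P; rewrite dy.
have au := triangle_in ty yu ux uz.
have uy : u != y by rewrite eq_sym adj_neq.
set S' := S :\ y :\ x :\ z.
have inS' w : (w \in S') = [&& w != z, w != x, w != y & w \in S] by rewrite !inE.
have sS : S' \subset S by apply/subsetP => w; rewrite inS' => /and4P[].
have uS' : u \in S' by rewrite inS' uz ux uy uS.
(* The star replaces the lost arc from [u] to [y], so [adm_cap] still holds at [u]. *)
pose st' w := st w + (w == u).
(* An arc between a triangle of [S'] and the deleted triangle would have to point into both. *)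
have noT w p q : w \in S' -> p \in S' -> q \in S' -> triangle w p q ->
    forall r, adj w r -> r != p -> r != q -> r \in [set x; y; z] -> False.
  move=> wS pS qS tw r wr rp rq; have := triangle_in tw wr rp rq.
  rewrite !inE => arw /orP[/orP[]|] /eqP E; subst r.
  - by case/orP: (triangle_closed t arw) => /eqP E; move: wS; rewrite inS' E eqxx ?andbF.
  - by case/orP: (triangle_closed ty arw) => /eqP E; move: wS; rewrite inS' E eqxx ?andbF.
  - by case/orP: (triangle_closed tz arw) => /eqP E; move: wS; rewrite inS' E eqxx ?andbF.
have A' : admissible S' st'.
  split.
  - move=> w wS; have wS0 := subsetP sS _ wS; rewrite /st'.
    have le1 : #|succs S' w| + (w == u) <= #|succs S w|.
      case: eqP => [->|_]; last by rewrite addn0; exact: subset_leq_card (succs_sub _ _).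
      rewrite addn1 (cardsD1 y (succs S u)) inE yS au add1n ltnS.
      apply: subset_leq_card; apply/subsetP => r; rewrite in_setD1 ![in X in X -> _]inE.
      by rewrite inE => /andP[/and4P[_ _ -> ->] ->].
    have le2 : #|nbr S' w| + (w == u) <= #|nbr S w|.
      case: eqP => [->|_]; last by rewrite addn0; exact: subset_leq_card (nbr_sub _ _).
      rewrite addn1 (cardsD1 y (nbr S u)) inE yS adjC yu add1n ltnS.
      apply: subset_leq_card; apply/subsetP => r; rewrite in_setD1 ![in X in X -> _]inE.
      by rewrite inE => /andP[/and4P[_ _ -> ->] ->].
    by case: (adm_cap A wS0) => h; [left|right]; apply: leq_trans h; rewrite addnCA addnC leq_add2r.
  - move=> w p q wS pS qS tw; rewrite /st'.
    rewrite (adm_star A (subsetP sS _ wS) (subsetP sS _ pS) (subsetP sS _ qS) tw).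
    case: eqP => // E; exfalso; subst w.
    apply: (noT u p q wS pS qS tw y); rewrite ?inE ?eqxx ?orbT //.
    + by rewrite adjC.
    + by apply: contraTneq pS => <-; rewrite inS' eqxx !andbF.
    + by apply: contraTneq qS => <-; rewrite inS' eqxx !andbF.
  (* Hence triangles of [S'] keep all their neighbours, and [adm_comp] is inherited. *)
  - have deg w p q : w \in S' -> p \in S' -> q \in S' -> triangle w p q ->
      #|nbr S w| <= #|nbr S' w|.
      move=> wS pS qS tw; apply: subset_leq_card; apply/subsetP => r.
      rewrite !in_nbr => /andP[rS wr]; rewrite wr andbT inS' rS andbT.
      have [->|rp] := eqVneq r p; first by move: pS; rewrite inS' => /and4P[-> -> ->].
      have [->|rq] := eqVneq r q; first by move: qS; rewrite inS' => /and4P[-> -> ->].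
      have := noT w p q wS pS qS tw r wr rp rq.
      by rewrite !inE; case: eqP; case: eqP; case: eqP => //= _ _ _; case.
    move=> w p q wS pS qS tw.
    have tp : triangle p w q by rewrite -triangleC.
    have tq : triangle q w p by rewrite triangleC triangleAC.
    have := deg _ _ _ wS pS qS tw; have := deg _ _ _ pS wS qS tp.
    have := deg _ _ _ qS wS pS tq.
    have := adm_comp A (subsetP sS _ wS) (subsetP sS _ pS) (subsetP sS _ qS) tw.
    by clear; lia.
have xS1 : x \in S :\ y by rewrite !inE xney.
have zS1 : z \in S :\ y :\ x by rewrite !inE (eq_sym z) xnez (eq_sym z) ynez.
apply: (@bounded_step S S' st st' [set x]) => //.
- by rewrite sub1set.
- exact: indep1.
- move=> _ w /set1P -> wS; apply: contraTN wS => xw.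
  rewrite inS'; apply/negP => /and4P[wz _ wy wS].
  have : w \in nbr S x by rewrite in_nbr wS.
  by rewrite nx !inE (negbTE wz) (negbTE wy).
- by rewrite disjoints1 inS' eqxx andbF.
- apply: IH => //.
  rewrite (cardsD1 y S) yS (cardsD1 x (S :\ y)) xS1.
  by rewrite (cardsD1 z (S :\ y :\ x)) zS1 /= -/S'; clear; lia.
- have wst : weight st' S' = weight st S' + 1.
    rewrite /weight big_split /= -addnA; congr (_ + (_ + _)).
    rewrite (big_setD1 u uS') /= eqxx big1 ?addn0 // => w; rewrite in_setD1.
    by case/andP => /negbTE ->.
  rewrite cards1 wst (weight_del st yS) (weight_del st xS1) (weight_del st zS1).
  have := narcs_del yS; have := narcs_del xS1; have := narcs_sub (subD1set (S :\ y :\ x) z).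
  have := nbr_del x yS; rewrite xy dx.
  rewrite -/S' dy sx sy sz; clear; lia.
Qed.

(** * Local structure of a minimal counterexample *)

Hypothesis unbounded : ~ bounded S st.

(** Deleting the triangle and keeping [x] costs 24 against 19, so five lost arcs suffice. They exist
    if the degrees of [y] and [z] sum to at least 6; a sum of 4 is excluded by [adm_comp], and 5 is
    the pendant triangle. *)
Lemma minimal_no_deg2_triangle : no_deg2_triangle S.
Proof.
move=> x y z xS yS zS t; have := triangle_deg yS zS t.
rewrite leq_eqVlt => /orP[/eqP/esym dx|//]; case: unbounded.
case/and3P: (t) => xy yz xz.
have ty : triangle y x z by rewrite -triangleC.
have tz : triangle z x y by rewrite triangleC triangleAC.
have dy := triangle_deg xS zS ty; have dz := triangle_deg xS yS tz.
have dsum := adm_comp A xS yS zS t.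
have [/andP[/eqP dy3 /eqP dz2]|h1] := boolP ((#|nbr S y| == 3) && (#|nbr S z| == 2)).
  exact: (pendant_triangle_step xS yS zS t).
have [/andP[/eqP dz3 /eqP dy2]|h2] := boolP ((#|nbr S z| == 3) && (#|nbr S y| == 2)).
  by apply: (pendant_triangle_step xS zS yS _ dx dy2 dz3); rewrite triangleAC.
have d6 : 6 <= #|nbr S y| + #|nbr S z|.
  by move: h1 h2 dsum dy dz; rewrite dx; clear; lia.
have xney := adj_neq xy; have ynez := adj_neq yz; have xnez := adj_neq xz.
have nx := triangle_nbr yS zS t (eq_leq dx).
have sx := adm_star A xS yS zS t; have sy := adm_star A yS xS zS ty.
have sz := adm_star A zS xS yS tz.
set S' := S :\ y :\ z :\ x.
have inS' w : (w \in S') = [&& w != x, w != z, w != y & w \in S] by rewrite !inE.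
have sS : S' \subset S by apply/subsetP => w; rewrite inS' => /and4P[].
have zS1 : z \in S :\ y by rewrite !inE eq_sym ynez.
have xS1 : x \in S :\ y :\ z by rewrite !inE xnez xney.
apply: (@bounded_step S S' st st [set x]) => //.
- by rewrite sub1set.
- exact: indep1.
- move=> _ w /set1P -> wS; apply: contraTN wS => xw.
  rewrite inS'; apply/negP => /and4P[_ wz wy wS].
  have : w \in nbr S x by rewrite in_nbr wS.
  by rewrite nx !inE (negbTE wz) (negbTE wy).
- by rewrite disjoints1 inS' eqxx.
- apply: IH.
    rewrite (cardsD1 y S) yS (cardsD1 z (S :\ y)) zS1.
    by rewrite (cardsD1 x (S :\ y :\ z)) xS1 /= -/S'; clear; lia.
  apply: (admissible_sub sS A) => p q r pS qS rS tp np nq nr.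
  have tq : triangle q p r by rewrite -triangleC.
  have tr : triangle r p q by rewrite triangleC triangleAC.
  (* No arc joins the deleted triangle to an isolated triangle of [S'], so the latter was isolated
     in [S] as well. *)
  have far f g h : f \in S' -> g \in S' -> h \in S' -> triangle f g h ->
      nbr S' f = [set g; h] -> #|nbr S f| <= 2.
    move=> fS gS hS tf nf; rewrite -[2]/(1.+1) -(_ : #|[set g; h]| = 2); last first.
      by rewrite cards2; case/and3P: tf => _ /adj_neq ->.
    rewrite -nf; apply: subset_leq_card; apply/subsetP => u.
    rewrite !in_nbr => /andP[uS fu]; rewrite fu andbT inS' uS andbT.
    have [->|ug] := eqVneq u g; first by move: gS; rewrite inS' => /and4P[-> -> ->].
    have [->|uh] := eqVneq u h; first by move: hS; rewrite inS' => /and4P[-> -> ->].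
    have auf := triangle_in tf fu ug uh.
    have out e e1 e2 : triangle e e1 e2 -> e1 \in [set x; y; z] ->
        e2 \in [set x; y; z] -> a e f -> False.
      move=> te; rewrite !inE => i1 i2 /(triangle_closed te).
      move: fS; rewrite inS' => /and4P[fx fz fy _].
      case/orP=> /eqP E; subst f.
        by move: i1; rewrite (negbTE fx) (negbTE fy) (negbTE fz).
      by move: i2; rewrite (negbTE fx) (negbTE fy) (negbTE fz).
    apply/and3P; split; apply/eqP => E; subst u.
    + by apply: (out _ _ _ t _ _ auf); rewrite !inE eqxx ?orbT.
    + by apply: (out _ _ _ tz _ _ auf); rewrite !inE eqxx ?orbT.
    + by apply: (out _ _ _ ty _ _ auf); rewrite !inE eqxx ?orbT.
  have := adm_comp A (subsetP sS _ pS) (subsetP sS _ qS) (subsetP sS _ rS) tp.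
  have := far _ _ _ pS qS rS tp np; have := far _ _ _ qS pS rS tq nq.
  have := far _ _ _ rS pS qS tr nr.
  by clear; lia.
- rewrite cards1 (weight_del st yS) (weight_del st zS1) (weight_del st xS1).
  move: (narcs_del yS) (narcs_del zS1) (narcs_sub (subD1set (S :\ y :\ z) x)).
  have := nbr_del z yS; rewrite adjC yz.
  by move: d6; rewrite -/S' sx sy sz; clear; lia.
Qed.

Let noT2 := minimal_no_deg2_triangle.

(** In degree 0 the cost of keeping [v] is at most 8 + 2. In degree 1 the neighbour is discarded as
    well and the cost is at most 16 + 2, still below 19. *)
Lemma minimal_deg_ge2 v : v \in S -> 1 < #|nbr S v|.
Proof.
move=> vS; rewrite ltnNge; apply/negP => dv; apply: unbounded.
have [/eqP|/card_gt0P[u]] := posnP #|nbr S v|.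
  rewrite cards_eq0 => /eqP nv0.
  have nv u : u \in S -> ~~ adj v u.
    by move=> uS; apply/negP => vu; have := in_set0 u; rewrite -nv0 in_nbr uS vu.
  have sS := subD1set S v.
  apply: (@bounded_step S (S :\ v) st st [set v]) => //.
  - by rewrite sub1set.
  - exact: indep1.
  - by move=> _ w /set1P -> /(subsetP sS)/nv.
  - by rewrite disjoints1 !inE eqxx.
  - apply: IH; first by rewrite (cardsD1 v S) vS.
    apply: (admissible_del sS noT2 A) => x y z ux _ _ xS _ _ _ _ _ uxS _ _ ax _ _.
    move: uxS; rewrite !inE; case: eqP => [E _|_]; last by rewrite andNb.
    by have := nv _ (subsetP sS _ xS); rewrite /adj -E ax.
  - rewrite cards1 (weight_del st vS).
    move: (narcs_sub sS) (adm_cap A vS); clear; lia.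
rewrite in_nbr => /andP[uS vu].
have nv w : w \in S -> adj v w -> w = u.
  move=> wS vw; apply/eqP/negPn/negP => wu.
  by have := card_nbr_ge2 wS uS wu vw vu; rewrite ltnNge dv.
set S' := S :\ u :\ v.
have sS : S' \subset S by rewrite subDset subsetU // subD1set orbT.
have vneu := adj_neq vu.
have vS1 : v \in S :\ u by rewrite !inE vneu.
have uv : adj u v by rewrite adjC.
have du : 0 < #|nbr S u| by apply/card_gt0P; exists v; rewrite in_nbr vS.
have dv0 : 0 < #|nbr S v| by apply/card_gt0P; exists u; rewrite in_nbr uS.
have inS' w : (w \in S') = [&& w != v, w != u & w \in S] by rewrite !inE.
apply: (@bounded_step S S' st st [set v]) => //.
- by rewrite sub1set.
- exact: indep1.
- move=> _ w /set1P ->; rewrite inS' => /and3P[_ wu wS].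
  by apply: contraNN wu => /(nv w wS) ->.
- by rewrite disjoints1 inS' eqxx.
- apply: IH.
    by rewrite (cardsD1 u S) uS (cardsD1 v (S :\ u)) vS1 /= -/S'; clear; lia.
  (* Only [u] sends arcs into [S'], and because of its neighbour [v] at most one, while a new
     triangle component receives three. *)
  have pred_u c x : x \in S' -> c \in S :\: S' -> a c x -> c = u.
    move=> xS; rewrite inE inS'; have [-> _ vx|_] := eqVneq c v.
      move: xS; rewrite inS' => /and3P[_ xu xS].
      by case/eqP: xu; apply: nv; rewrite // /adj vx.
    by case: eqP => //= _; rewrite andNb.
  apply: (admissible_del sS noT2 A) => x y z ux uy _ xS yS _ xy _ _ uxS uyS _ ax ay _.
  move: (ax) (ay); rewrite (pred_u _ _ xS uxS ax) (pred_u _ _ yS uyS ay) => {}ax {}ay.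
  move: xS yS; rewrite !inS' => /and3P[xv _ xS] /and3P[yv _ yS].
  move: xv yv; rewrite ![_ == v]eq_sym => vx vy.
  by case/eqP: xy; apply: (arc_unique A uS vS uv xS yS vx vy ax ay).
- rewrite cards1 (weight_del st uS) (weight_del st vS1).
  move: (narcs_sub sS) (star_le1 A uS du) (star_le1 A vS dv0) (narcs_del uS).
  move: (narcs_sub (subD1set (S :\ u) v)) du.
  by rewrite -/S'; clear; lia.
Qed.

(** Deleting all three and keeping [v] costs 24 plus the stars; 19 and the degrees of [u] and [w]
    would pay for it. These degrees count no adjacency twice, because [v] is in no triangle. *)
Lemma minimal_deg2_sum v u w : v \in S -> #|nbr S v| = 2 ->
    u \in S -> w \in S -> u != w -> adj v u -> adj v w ->
  #|nbr S u| + #|nbr S w| <= 4 + st v + st u + st w.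
Proof.
move=> vS dv uS wS uw vu vw; rewrite leqNgt; apply/negP => d5; apply: unbounded.
have [w' [uw' w'S vw' nv]] := nbr2_other dv uS vu.
have {uw' w'S vw'} ww' : w' = w.
  by have := nv w wS vw; rewrite eq_sym (negbTE uw) => /eqP.
subst w'.
have nuw : adj u w = false.
  apply/negP => auw; have := noT2 vS uS wS.
  by rewrite /triangle vu vw auw dv => /(_ isT).
set S' := S :\ u :\ w :\ v.
have inS' x : (x \in S') = [&& x != v, x != w, x != u & x \in S] by rewrite !inE.
have sS : S' \subset S by apply/subsetP => x; rewrite inS' => /and4P[].
have wS1 : w \in S :\ u by rewrite !inE eq_sym uw.
have vS1 : v \in S :\ u :\ w by rewrite !inE (adj_neq vu) (adj_neq vw).
apply: (@bounded_step S S' st st [set v]) => //.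
- by rewrite sub1set.
- exact: indep1.
- move=> _ x /set1P ->; rewrite inS' => /and4P[_ xw xu xS].
  by apply/negP => /(nv x xS); rewrite (negbTE xw) (negbTE xu).
- by rewrite disjoints1 inS' eqxx.
- apply: IH.
    rewrite (cardsD1 u S) uS (cardsD1 w (S :\ u)) wS1.
    by rewrite (cardsD1 v (S :\ u :\ w)) vS1 /= -/S'; clear; lia.
  have pred_uw c x : x \in S' -> c \in S :\: S' -> a c x -> (c == u) || (c == w).
    move=> xS; rewrite inE inS' => /andP[h cS] cx.
    have cv : c != v.
      apply: contraTneq xS => E; have vx : adj v x by rewrite -E /adj cx.
      rewrite inS'; apply/negP => /and4P[_ xw xu xS].
      by have := nv x xS vx; rewrite (negbTE xw) (negbTE xu).
    by move: h; rewrite cv cS !andbT /= negb_and !negbK orbC.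
  (* So [u] and [w] together send at most two arcs into [S'], fewer than a new triangle component
     receives. *)
  have uniq_pred c x y : (c == u) || (c == w) -> x \in S' -> y \in S' ->
      a c x -> a c y -> x = y.
    rewrite !inS' => ec /and4P[xv _ _ xS] /and4P[yv _ _ yS].
    move: xv yv; rewrite ![_ == v]eq_sym => xv yv.
    case/orP: ec => /eqP ->; apply: (arc_unique A _ vS _ xS yS xv yv) => //.
      by rewrite adjC.
    by rewrite adjC.
  apply: (admissible_del sS noT2 A).
  move=> x y z ux uy uz xS yS zS xy yz xz uxS uyS uzS ax ay az.
  have cx := pred_uw _ _ xS uxS ax; have cy := pred_uw _ _ yS uyS ay.
  have cz := pred_uw _ _ zS uzS az.
  have uxy : ux != uy.
    by apply: contraNneq xy => E; apply/eqP/(uniq_pred _ _ _ cx xS yS ax); rewrite E.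
  have uyz : uy != uz.
    by apply: contraNneq yz => E; apply/eqP/(uniq_pred _ _ _ cy yS zS ay); rewrite E.
  have uxz : ux != uz.
    by apply: contraNneq xz => E; apply/eqP/(uniq_pred _ _ _ cx xS zS ax); rewrite E.
  case/orP: cx uxy uxz => /eqP ->; case/orP: cy uyz => /eqP ->;
    by case/orP: cz => /eqP ->; rewrite ?eqxx.
- rewrite cards1 (weight_del st uS) (weight_del st wS1) (weight_del st vS1).
  move: (narcs_del uS) (narcs_del wS1) (narcs_sub (subD1set (S :\ u :\ w) v)).
  have := nbr_del w uS; rewrite adjC nuw.
  by move: d5; rewrite -/S'; clear; lia.
Qed.

(** Keep [v1] and [v2], and discard [x] and their other neighbours [a1] and [a2]. The cost is at
    most 40 plus 3 for stars; the gain is 38 plus at least 5 arcs, from three degrees of at least 2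
    with at most one adjacency counted twice. *)
Lemma minimal_deg2_nbr_unique x v1 v2 : x \in S -> v1 \in S -> v2 \in S ->
  adj x v1 -> adj x v2 -> #|nbr S v1| = 2 -> #|nbr S v2| = 2 -> v1 = v2.
Proof.
move=> xS v1S v2S xv1 xv2 d1 d2; apply/eqP/negPn/negP => v12; apply: unbounded.
have v1x : adj v1 x by rewrite adjC.
have v2x : adj v2 x by rewrite adjC.
have n12 : adj v1 v2 = false.
  apply/negP => h; have := noT2 v1S xS v2S.
  by rewrite /triangle v1x xv2 h d1 => /(_ isT).
have [a1 [xa1 a1S va1 nv1]] := nbr2_other d1 xS v1x.
have [a2 [xa2 a2S va2 nv2]] := nbr2_other d2 xS v2x.
have a1v1 : adj a1 v1 by rewrite adjC.
have a2v2 : adj a2 v2 by rewrite adjC.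
have nxa1 : adj x a1 = false.
  apply/negP => h; have := noT2 v1S xS a1S.
  by rewrite /triangle v1x va1 h d1 => /(_ isT).
have nxa2 : adj x a2 = false.
  apply/negP => h; have := noT2 v2S xS a2S.
  by rewrite /triangle v2x va2 h d2 => /(_ isT).
have a1v2 : a1 != v2 by apply: contraTneq va1 => ->; rewrite n12.
have a2v1 : a2 != v1 by apply: contraTneq va2 => ->; rewrite adjC n12.
have v1nx := adj_neq v1x; have v2nx := adj_neq v2x.
have v1a1 := adj_neq va1; have v2a2 := adj_neq va2.
have dx := minimal_deg_ge2 xS.
have da1 := minimal_deg_ge2 a1S; have da2 := minimal_deg_ge2 a2S.
have s1 : st v1 + st a1 <= 1 by apply: (star_adj A) => //; rewrite d1.
have s2 : st v2 + st a2 <= 1 by apply: (star_adj A) => //; rewrite d2.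
have sx : st x <= 1 by apply: (star_le1 A xS); apply: ltnW.
set S0 := S :\ x :\ a1 :\ a2.
set S' := S0 :\ v1 :\ v2.
have inS' y : (y \in S') =
    [&& y != v2, y != v1, y != a2, y != a1, y != x & y \in S] by rewrite !inE.
have sS : S' \subset S by apply/subsetP => y; rewrite inS' => /and5P[_ _ _ _ /andP[]].
have v1S0 : v1 \in S0 by rewrite !inE (eq_sym v1 a2) a2v1 v1a1 v1nx.
have v2S0 : v2 \in S0 :\ v1 by rewrite !inE eq_sym v12 v2a2 (eq_sym v2 a1) a1v2 v2nx.
have cardJ : #|[set v1; v2]| = 2 by rewrite cards2 v12.
apply: (@bounded_step S S' st st [set v1; v2]) => //.
- by apply/subsetP => y; rewrite !inE => /orP[] /eqP ->.
- move=> y z; rewrite !inE => /orP[] /eqP -> /orP[] /eqP ->;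
  by rewrite ?adj_irr // ?n12 // adjC n12.
- move=> y z /set2P[] ->; rewrite inS' => /and5P[_ _ z2 z1 /andP[zx zS]].
    by apply/negP => /(nv1 z zS); rewrite (negbTE z1) (negbTE zx).
  by apply/negP => /(nv2 z zS); rewrite (negbTE z2) (negbTE zx).
- rewrite disjoint_subset; apply/subsetP => y.
  by rewrite !inE => /orP[] /eqP ->; rewrite eqxx ?andbF.
- apply: IH.
    apply: proper_card; apply/properP; split=> //; exists x => //.
    by rewrite inS' eqxx !andbF.
  have pred3 c y : y \in S' -> c \in S :\: S' -> a c y ->
      [|| c == x, c == a1 | c == a2].
    move=> yS; rewrite inE inS' => /andP[h cS] cy.
    have cv1 : c != v1.
      apply: contraTneq yS => E; have vy : adj v1 y by rewrite -E /adj cy.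
      rewrite inS'; apply/negP => /and5P[_ _ _ y1 /andP[yx yS]].
      by have := nv1 y yS vy; rewrite (negbTE y1) (negbTE yx).
    have cv2 : c != v2.
      apply: contraTneq yS => E; have vy : adj v2 y by rewrite -E /adj cy.
      rewrite inS'; apply/negP => /and5P[_ _ y2 _ /andP[yx yS]].
      by have := nv2 y yS vy; rewrite (negbTE y2) (negbTE yx).
    move: h; rewrite cv1 cv2 cS !andbT /= !negb_and !negbK.
    by case: (c == x); case: (c == a1); case: (c == a2).
  have uniq_pred c y z : [|| c == x, c == a1 | c == a2] -> y \in S' -> z \in S' ->
      a c y -> a c z -> y = z.
    rewrite !inS' => ec /and5P[y2 y1 _ _ /andP[_ yS]] /and5P[z2 z1 _ _ /andP[_ zS]].
    rewrite eq_sym in y1; rewrite eq_sym in y2.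
    rewrite eq_sym in z1; rewrite eq_sym in z2.
    case/or3P: ec => /eqP ->.
    + exact: (arc_unique A xS v1S xv1 yS zS y1 z1).
    + exact: (arc_unique A a1S v1S a1v1 yS zS y1 z1).
    + exact: (arc_unique A a2S v2S a2v2 yS zS y2 z2).
  (* Such a pair of arcs rules out stars at [x], [a1] and [v1], so that the degrees
     around [v1] are too large for [minimal_deg2_sum]. *)
  have no_xa1 y z : y \in S' -> z \in S' -> a x y -> a a1 z -> False.
    rewrite !inS' => /and5P[y2 y1 _ _ /andP[_ yS]] /and5P[_ _ _ _ /andP[_ zS]] xy az.
    have sx0 := star_sink A xS dx yS xy; have sa0 := star_sink A a1S da1 zS az.
    have sv0 : st v1 = 0.
      case/orP: v1x => h; first by apply: (star_sink A v1S _ xS h); rewrite d1.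
      rewrite eq_sym in y1; rewrite eq_sym in y2; rewrite eq_sym in v12.
      have := arc_unique A xS v2S xv2 v1S yS v12 y2 h xy.
      by move/eqP; rewrite (negbTE y1).
    have dx3 : 2 < #|nbr S x|.
      rewrite eq_sym in y1; rewrite eq_sym in y2.
      by apply: (card_nbr_ge3 v1S v2S yS v12 y1 y2 xv1 xv2); rewrite /adj xy.
    have := minimal_deg2_sum v1S d1 xS a1S xa1 v1x va1.
    by move: dx3 da1; rewrite sx0 sa0 sv0; clear; lia.
  apply: (admissible_del sS noT2 A).
  move=> y z t uy uz ut yS zS tS yz zt yt uyS uzS utS ay az at_.
  have cy := pred3 _ _ yS uyS ay; have cz := pred3 _ _ zS uzS az.
  have ct := pred3 _ _ tS utS at_.
  have uyz : uy != uz.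
    by apply: contraNneq yz => E; apply/eqP/(uniq_pred _ _ _ cy yS zS ay); rewrite E.
  have uzt : uz != ut.
    by apply: contraNneq zt => E; apply/eqP/(uniq_pred _ _ _ cz zS tS az); rewrite E.
  have uyt : uy != ut.
    by apply: contraNneq yt => E; apply/eqP/(uniq_pred _ _ _ cy yS tS ay); rewrite E.
  (* Three distinct senders among [x], [a1] and [a2] include both [x] and [a1], which [no_xa1]
     excludes. *)
  case/or3P: cy uyz uyt ay => /eqP -> uyz uyt ay;
    case/or3P: cz uyz uzt az => /eqP -> uyz uzt az;
    case/or3P: ct uyt uzt at_ => /eqP -> uyt uzt at_;
    first [ by rewrite eqxx in uyz | by rewrite eqxx in uyt | by rewrite eqxx in uzt
          | exact: (no_xa1 _ _ yS zS ay az) | exact: (no_xa1 _ _ yS tS ay at_)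
          | exact: (no_xa1 _ _ zS yS az ay) | exact: (no_xa1 _ _ zS tS az at_)
          | exact: (no_xa1 _ _ tS yS at_ ay) | exact: (no_xa1 _ _ tS zS at_ az)].
- have a1S1 : a1 \in S :\ x by rewrite !inE eq_sym xa1.
  have wS0 : weight st S0 = weight st S' + 16 + st v1 + st v2.
    by rewrite (weight_del st v1S0) (weight_del st v2S0) -/S'; clear; lia.
  have nS0 : narcs S' <= narcs S0.
    exact: leq_trans (narcs_sub (subD1set _ _)) (narcs_sub (subD1set _ _)).
  have := narcs_del xS; have := narcs_del a1S1.
  have := nbr_del a1 xS; rewrite (adjC a1 x) nxa1 addn0 => <-.
  rewrite cardJ (weight_del st xS) (weight_del st a1S1).
  (* If [a1] and [a2] coincide, only four vertices go and the cost is at most 35, below 38. *)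
  have [E|a12] := eqVneq a1 a2.
    have -> : S :\ x :\ a1 = S0.
      by rewrite /S0 -E; apply/setP => y; rewrite !inE; case: (y == a1).
    by move: nS0 s1 s2 sx; rewrite wS0; clear; lia.
  have a2S1 : a2 \in S :\ x :\ a1 by rewrite !inE (eq_sym a2 a1) a12 (eq_sym a2 x) xa2.
  rewrite (weight_del st a2S1) -/S0 wS0; move: (narcs_del a2S1).
  have := nbr_del a2 a1S1; have := nbr_del a2 xS; rewrite (adjC a2 x) nxa2 addn0 => <-.
  by move: nS0 s1 s2 sx dx da1 da2; case: (adj a2 a1); rewrite -/S0; clear; lia.
Qed.

(** Each vertex has at most one neighbour outside [O], and on [O] outdegree plus stars is at most 1.
    Counting leaves no slack, so [O] sends no arc out and carries no star; the surroundings of a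
    degree-2 neighbour of [O] then give a contradiction. *)
Lemma minimal_empty : S = set0.
Proof.
pose O := [set x in S | 2 < #|nbr S x|].
have OS : O \subset S by apply/subsetP => x; rewrite inE => /andP[].
have deg2 x : x \in S -> x \notin O -> #|nbr S x| = 2.
  move=> xS; rewrite inE xS /= -leqNgt => le; apply/eqP.
  by rewrite eqn_leq le minimal_deg_ge2.
have F1 x : x \in S -> #|nbr S x| <= #|nbr O x| + 1.
  move=> xS; rewrite -(cardsID O (nbr S x)); apply: leq_add.
    apply: subset_leq_card; apply/subsetP => y.
    by rewrite !inE => /andP[/andP[_ ->] /andP[-> ->]].
  apply/card_le1_eqP => y z; rewrite !inE -/O.
  case/andP=> yO /andP[yS xy] /andP[zO /andP[zS xz]].
  apply: (minimal_deg2_nbr_unique xS) => //; apply: deg2 => //.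
    by rewrite inE.
  by rewrite inE.
have F1O x : x \in O -> 1 < #|nbr O x|.
  by rewrite inE => /andP[xS]; move: (F1 x xS); clear; lia.
have F2 x : x \in O -> #|succs S x| + st x <= 1.
  by rewrite inE => /andP[xS]; case: (adm_cap A xS) => //; clear; lia.
have F2O x : x \in O -> #|succs O x| <= 1.
  move=> xO; apply: leq_trans (F2 x xO).
  exact: leq_trans (subset_leq_card (succs_sub x OS)) (leq_addr _ _).
have F3 : \sum_(x in O) #|nbr O x| <= 2 * narcs O.
  have -> : 2 * narcs O = \sum_(x in O) (#|succs O x| + \sum_(y in O) a y x).
    rewrite big_split /= mul2n -addnn; congr (_ + _); rewrite exchange_big /=.
    apply: eq_bigr => x _; rewrite -sum1_card big_mkcond [RHS]big_mkcond /=.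
    by apply: eq_bigr => y _; rewrite inE; case: (y \in O).
  by apply: leq_sum => x _; rewrite sum_preds card_nbr_le.
(* Equality holds throughout in [2 |O| <= sum of degrees <= 2 narcs O <= 2 |O|]. *)
have F4 x : x \in O -> #|succs O x| = 1 /\ #|nbr O x| = 2.
  move=> xO; have := F3; rewrite /narcs !(big_setD1 x xO) /=.
  have : 2 * #|O :\ x| <= \sum_(y in O :\ x) #|nbr O y|.
    rewrite mulnC -sum_nat_const; apply: leq_sum => y.
    by rewrite in_setD1 => /andP[_ /F1O].
  have : \sum_(y in O :\ x) #|succs O y| <= #|O :\ x|.
    rewrite -[leqRHS]muln1 -sum_nat_const; apply: leq_sum => y.
    by rewrite in_setD1 => /andP[_ /F2O].
  by move: (F1O x xO) (F2O x xO); clear; lia.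
(* The one arc that [F2] allows out of [x] already ends in [O]. *)
have F5 x y : x \in O -> y \in S -> a x y -> y \in O.
  move=> xO yS xy; apply/negPn/negP => yO.
  have [/eqP/cards1P[z sz] _] := F4 x xO.
  have : z \in succs O x by rewrite sz set11.
  rewrite inE => /andP[zO xz].
  have := succs_ge2 yS (subsetP OS _ zO) _ xy xz.
  have -> : y != z by apply: contraNneq yO => ->.
  by move=> /(_ isT); move: (F2 x xO); clear; lia.
have F6 x : x \in O -> st x = 0.
  move=> xO; have := F2 x xO; have := subset_leq_card (succs_sub x OS).
  by have [-> _] := F4 x xO; clear; lia.
apply/eqP; apply: contraT => /set0Pn[x0 x0S].
have [x xO] : exists x, x \in O.
  have [|x0O] := boolP (x0 \in O); first by exists x0.
  have := deg2 x0 x0S x0O; have := F1 x0 x0S => + d2.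
  rewrite d2 addn1 ltnS => /card_gt0P[y].
  by rewrite in_nbr => /andP[yO _]; exists y.
have xS := subsetP OS _ xO.
have [v [vS xv vO]] : exists v, [/\ v \in S, adj x v & v \notin O].
  have : 0 < #|nbr S x :\: nbr O x|.
    have [_ d2] := F4 x xO; rewrite cardsD.
    have := subset_leq_card (subsetIr (nbr S x) (nbr O x)); rewrite d2.
    by move: xO; rewrite inE => /andP[_]; clear; lia.
  case/card_gt0P=> v; rewrite inE !in_nbr negb_and => /andP[+ /andP[vS xv]].
  by rewrite xv orbF => vO; exists v.
have dv := deg2 v vS vO.
have vx : adj v x by rewrite adjC.
have avx : a v x.
  by case/orP: (vx) => // /(F5 x v xO vS); rewrite (negbTE vO).
have sv : st v = 0 by apply: (star_sink A vS _ xS avx); rewrite dv.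
have [u [xu uS vu nv]] := nbr2_other dv xS vx.
have := minimal_deg2_sum vS dv xS uS xu vx vu; rewrite sv (F6 x xO).
have dx : 2 < #|nbr S x| by move: xO; rewrite inE => /andP[].
(* The degrees of [x] and [u] sum to at most 4 plus [st u]. In [O] the vertex [u] has no star and
   degree at least 3; otherwise it must carry a star. *)
have [uO|uO] := boolP (u \in O).
  rewrite (F6 u uO); move: dx; have : 2 < #|nbr S u| by move: uO; rewrite inE => /andP[].
  by clear; lia.
have du := deg2 u uS uO; rewrite du => le.
have su : 0 < st u by move: le dx; clear; lia.
have uv : adj u v by rewrite adjC.
have [w [vw wS uw nu]] := nbr2_other du vS uv.
(* The starred [u] sends no arc, [O] sends none to [u], and [u] cannot have the two degree-2
   neighbours [v] and [w]. *)
have [wO|wO] := boolP (w \in O).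
  case/orP: (uw) => [auw|awu].
    by move: su; rewrite (star_sink A uS _ wS auw) ?du.
  by have := F5 w u wO uS awu; rewrite (negbTE uO).
have := minimal_deg2_nbr_unique uS vS wS uv uw dv (deg2 w wS wO).
by move/eqP; rewrite (negbTE vw).
Qed.

End Step.

(** There are finitely many candidate sets, so the case distinction in the induction is
    decidable. *)
Lemma boundedP S st : reflect (bounded S st)
  [exists I : {set T}, [&& I \subset S, [forall x in I, forall y in I, ~~ adj x y]
     & weight st S <= 19 * #|I| + narcs S]].
Proof.
apply: (iffP existsP) => -[I].
  case/and3P => IS Ii wI; exists I; split=> // x y xI yI.
  by move/forall_inP: Ii => /(_ x xI)/forall_inP/(_ y yI).
case=> IS Ii wI; exists I; rewrite IS wI andbT /=.
by apply/forall_inP => x xI; apply/forall_inP => y yI; apply: Ii.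
Qed.

Lemma admissible_bounded S st : admissible S st -> bounded S st.
Proof.
have [n] := ubnP #|S|; elim: n S st => // n IHn S st; rewrite ltnS => le A.
have [//|nb] := boundedP S st.
have IH S' st' : #|S'| < #|S| -> admissible S' st' -> bounded S' st'.
  by move=> lt; apply: IHn; apply: leq_trans lt le.
rewrite (minimal_empty A IH nb); exists set0; split=> //.
  by move=> x y; rewrite inE.
by rewrite /weight cards0 big_set0.
Qed.

End ArcGraph.

(** * The oriented line graph of a digraph in [D(1,1)] *)

Section LineGraph.

Context (V : finType) (e : rel V).

Hypothesis e_irr : irreflexive e.
Hypothesis D11 : in_D e 1 1.

(** The arc points to the centre [q] of the star at the shared vertex: [q] is the only edge entering
    the tail of [p], or the only edge leaving its head. *)
Definition line_arc (p q : V * V) :=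
  [&& e p.1 p.2, e q.1 q.2 &
    (q.2 == p.1) && (indeg e p.1 <= 1) || (p.2 == q.1) && ~~ (indeg e p.2 <= 1)].

Let A := line_arc.

Lemma in_edge_unique x u w : indeg e x <= 1 -> e u x -> e w x -> u = w.
Proof. by move/card_le1_eqP => h ux wx; apply: h; rewrite inE. Qed.

Lemma out_edge_unique x u w : ~~ (indeg e x <= 1) -> e x u -> e x w -> u = w.
Proof.
move=> dx xu xw; case: (D11 x) => [h|/card_le1_eqP h]; first by rewrite h in dx.
by apply: h; rewrite inE.
Qed.

Lemma line_arc_irr : irreflexive A.
Proof.
move=> [x y]; apply/negP; rewrite /A /line_arc /= => /and3P[xy _].
by case/orP=> /andP[/eqP E _]; move: xy; rewrite E e_irr.
Qed.

Lemma line_adj p q : adj A p q =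
  [&& e p.1 p.2, e q.1 q.2 & (q.2 == p.1) || (p.2 == q.1)].
Proof.
rewrite /adj /A /line_arc; case: (e p.1 p.2) => //=; case: (e q.1 q.2) => //=.
case: (q.2 =P p.1) => [->|_]; case: (p.2 =P q.1) => [->|_] //=;
  by case: (indeg e p.1 <= 1); case: (indeg e q.1 <= 1).
Qed.

(** Any choice of directions that is not cyclic would create a loop. *)
Lemma line_triangle p q r : triangle A p q r ->
  (p.2 = q.1 /\ q.2 = r.1 /\ r.2 = p.1) \/ (p.2 = r.1 /\ r.2 = q.1 /\ q.2 = p.1).
Proof.
case: p q r => [p1 p2] [q1 q2] [r1 r2]; rewrite /triangle !line_adj /=.
case/and3P=> /and3P[ep eq hpq] /and3P[_ er hqr] /and3P[_ _ hpr].
have np : p1 != p2 by apply: contraTneq ep => ->; rewrite e_irr.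
have nq : q1 != q2 by apply: contraTneq eq => ->; rewrite e_irr.
have nr : r1 != r2 by apply: contraTneq er => ->; rewrite e_irr.
case/orP: hpq => /eqP h1; case/orP: hqr => /eqP h2; case/orP: hpr => /eqP h3;
  subst; rewrite ?eqxx // in np nq nr *; auto.
Qed.

(** The edges before and after [p] in the directed triangle are [q] and [r]; an arc from [p] ends in
    the unique edge entering its tail or leaving its head, which is one of them. *)
Lemma line_triangle_closed p q r s :
  triangle A p q r -> A p s -> (s == q) || (s == r).
Proof.
move=> t; have := line_triangle t; case/and3P: t.
case: p q r s => [p1 p2] [q1 q2] [r1 r2] [s1 s2]; rewrite !line_adj /A /line_arc /=.
case/and3P=> _ eq _ /and3P[_ er _] _ h /and3P[ep es].
case/orP=> /andP[/eqP E d]; subst.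
- case: h => [[? [? ?]]|[? [? ?]]]; subst.
  + by rewrite (in_edge_unique d es er) eqxx orbT.
  + by rewrite (in_edge_unique d es eq) eqxx.
- case: h => [[? [? ?]]|[? [? ?]]]; subst.
  + by rewrite (out_edge_unique d es eq) eqxx.
  + by rewrite (out_edge_unique d es er) eqxx orbT.
Qed.

Definition low_to_high := [set p in edges e | (indeg e p.1 <= 1) && ~~ (indeg e p.2 <= 1)].

(** An arc at the tail of [p] needs indegree at most 1 there, an arc at the head needs a larger
    indegree, and each leads to a unique centre. *)
Lemma card_line_succs S p : #|succs A S p| <= 1 + (p \in low_to_high).
Proof.
case: p => x y.
have : succs A S (x, y) \subset
    [set q in succs A S (x, y) | (q.2 == x) && (indeg e x <= 1)] :|:
    [set q in succs A S (x, y) | (y == q.1) && ~~ (indeg e y <= 1)].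
  by apply/subsetP => -[u w]; rewrite !inE /A /line_arc /= => /andP[-> /and3P[-> -> h]];
    rewrite h.
move/subset_leq_card/leq_trans => /(_ _ (leq_card_setU _ _).1).
have le1 : #|[set q in succs A S (x, y) | (q.2 == x) && (indeg e x <= 1)]|
    <= (indeg e x <= 1).
  case: (boolP (indeg e x <= 1)) => d; last first.
    by rewrite leqn0 cards_eq0; apply/eqP/setP => q; rewrite !inE !andbF.
  apply/card_le1_eqP => -[u u'] [w w']; rewrite !inE !andbT /A /line_arc /=.
  case/andP=> /and3P[_ _ /andP[eu _]] /eqP E /andP[/and3P[_ _ /andP[ew _]] /eqP E'].
  by subst; rewrite (in_edge_unique d eu ew).
have le2 : #|[set q in succs A S (x, y) | (y == q.1) && ~~ (indeg e y <= 1)]|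
    <= ~~ (indeg e y <= 1).
  case: (boolP (indeg e y <= 1)) => d.
    by rewrite leqn0 cards_eq0; apply/eqP/setP => q; rewrite !inE !andbF.
  apply/card_le1_eqP => -[u u'] [w w']; rewrite !inE !andbT /A /line_arc /=.
  case/andP=> /and3P[_ _ /andP[eu _]] /eqP E /andP[/and3P[_ _ /andP[ew _]] /eqP E'].
  by subst; rewrite (out_edge_unique d eu ew).
have [xy|nxy] := boolP (e x y); last first.
  have -> : succs A S (x, y) = set0; last by rewrite cards0.
  by apply/setP => q; rewrite !inE /A /line_arc (negbTE nxy) andbF.
move=> h; apply: leq_trans h _; apply: leq_trans (leq_add le1 le2) _.
by rewrite !inE /= xy /=; case: (indeg e x <= 1); case: (indeg e y <= 1).
Qed.

(** Only the single edge entering the tail can precede [p], and only the single edge leaving the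
    head can follow it. *)
Lemma card_line_nbr S p : p \in low_to_high -> #|nbr A S p| <= 2.
Proof.
case: p => x y; rewrite !inE /= => /and3P[xy dx dy].
have : nbr A S (x, y) \subset
    [set q in nbr A S (x, y) | q.2 == x] :|: [set q in nbr A S (x, y) | y == q.1].
  apply/subsetP => -[u w]; rewrite !inE line_adj /=.
  by case/and4P=> -> -> -> h; rewrite h.
move/subset_leq_card/leq_trans => /(_ _ (leq_card_setU _ _).1)/leq_trans; apply.
rewrite -[2]/(1 + 1); apply: leq_add.
  apply/card_le1_eqP => -[u u'] [w w']; rewrite !inE !line_adj /=.
  case/andP=> /and4P[_ _ eu _] /eqP E /andP[/and4P[_ _ ew _] /eqP E'].
  by subst; rewrite (in_edge_unique dx eu ew).
apply/card_le1_eqP => -[u u'] [w w']; rewrite !inE !line_adj /=.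
case/andP=> /and4P[_ _ eu _] /eqP E /andP[/and4P[_ _ ew _] /eqP E'].
by subst; rewrite (out_edge_unique dy eu ew).
Qed.

Lemma low_to_high_indep : indep A low_to_high.
Proof.
move=> [x y] [u w]; rewrite !inE /= => /and3P[_ dx dy] /and3P[_ du dw].
rewrite line_adj /= !negb_and negb_or; apply/orP; right; apply/orP; right.
by apply/andP; split; [apply: contraNneq dw => -> | apply: contraNneq dy => ->].
Qed.

Lemma narcs_line : narcs A (edges e) <= #|edges e| + #|low_to_high|.
Proof.
have h : narcs A (edges e) <= \sum_(p in edges e) (1 + (p \in low_to_high)).
  by apply: leq_sum => p _; apply: card_line_succs.
apply: leq_trans h _.
rewrite big_split /= sum1_card leq_add2l -sum1_card.
rewrite big_mkcond [leqRHS]big_mkcond /=; apply: leq_sum => p _.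
by case: (p \in edges e); case: (p \in low_to_high).
Qed.

(** A triangle component of the line graph is a directed triangle that no further edge meets, so by
    connectivity it is the whole digraph. *)
Lemma line_admissible : connected_digraph e -> ~ directed_triangle e ->
  admissible A (edges e) (fun=> 0).
Proof.
move=> conn ntri; split=> //.
  move=> p _; rewrite !addn0; have := card_line_succs (edges e) p.
  case: (boolP (p \in low_to_high)) => pP; last by left.
  by right; apply: card_line_nbr.
move=> p q r pE qE rE t; rewrite ltnNge; apply/negP => le; apply: ntri.
have tq : triangle A q p r by rewrite -triangleC.
have tr : triangle A r p q by rewrite triangleC triangleAC.
have [np nq nr] : [/\ nbr A (edges e) p = [set q; r], nbr A (edges e) q = [set p; r]
    & nbr A (edges e) r = [set p; q]].
  have dp := triangle_deg line_arc_irr qE rE t.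
  have dq := triangle_deg line_arc_irr pE rE tq.
  have dr := triangle_deg line_arc_irr pE qE tr.
  have [lp lq lr] : [/\ #|nbr A (edges e) p| <= 2, #|nbr A (edges e) q| <= 2
      & #|nbr A (edges e) r| <= 2].
    by move: le dp dq dr; clear; split; lia.
  by split; apply: (triangle_nbr line_arc_irr).
wlog [pq [qr rp]] : q r qE rE t tq tr np nq nr {le} / p.2 = q.1 /\ q.2 = r.1 /\ r.2 = p.1.
  move=> W; case: (line_triangle t) => h; first exact: (W q r).
  apply: (W r q) => //; first by rewrite triangleAC.
  by rewrite setUC.
case: p q r pE qE rE t tq tr np nq nr pq qr rp => [x y] [y' z] [z' x'] pE qE rE t tq tr.
move=> np nq nr /= pq qr rp; subst y' z' x'.
move: (pE) (qE) (rE); rewrite !inE /= => exy eyz ezx.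
(* An edge at a vertex of the triangle is consecutive to a triangle edge, whose only neighbours are
   the other two. *)
have edge3 u w : e u w -> (u \in [set x; y; z]) || (w \in [set x; y; z]) ->
    (u, w) \in [set (x, y); (y, z); (z, x)].
  move=> uw h.
  have inp : (u == y) || (w == x) -> (u, w) \in nbr A (edges e) (x, y).
    by rewrite !inE line_adj /= uw exy /= (eq_sym y) orbC.
  have inq : (u == z) || (w == y) -> (u, w) \in nbr A (edges e) (y, z).
    by rewrite !inE line_adj /= uw eyz /= (eq_sym z) orbC.
  have inr : (u == x) || (w == z) -> (u, w) \in nbr A (edges e) (z, x).
    by rewrite !inE line_adj /= uw ezx /= (eq_sym x) orbC.
  have : [|| (u == y) || (w == x), (u == z) || (w == y) | (u == x) || (w == z)].
    by move: h; rewrite !inE -!orbA; do 6![case: eqP => _ //=].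
  case/or3P=> [/inp|/inq|/inr]; rewrite ?np ?nq ?nr !inE.
  - by case/orP=> ->; rewrite ?orbT.
  - by case/orP=> ->; rewrite ?orbT.
  - by case/orP=> ->; rewrite ?orbT.
have ends u w : (u, w) \in [set (x, y); (y, z); (z, x)] ->
    (u \in [set x; y; z]) && (w \in [set x; y; z]).
  by rewrite !inE -orbA => /or3P[] /eqP [-> ->]; rewrite !eqxx ?orbT.
have all3 v : v \in [set x; y; z].
  rewrite -(closed_connect _ (conn x v)) ?inE ?eqxx // => u w /= uw.
  have [iu|nu] := boolP (u \in _); have [iw|nw] := boolP (w \in _) => //.
    by case/orP: uw => /edge3; rewrite iu ?orbT => /(_ isT)/ends;
      rewrite (negbTE nw) ?andbF.
  by case/orP: uw => /edge3; rewrite iw ?orbT => /(_ isT)/ends;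
    rewrite (negbTE nu) ?andbF.
exists x, y, z; split.
- rewrite /= !inE negb_or !andbT.
  have -> : x != y by apply: contraTneq exy => ->; rewrite e_irr.
  have -> : y != z by apply: contraTneq eyz => ->; rewrite e_irr.
  by rewrite andbT /=; apply: contraTneq ezx => ->; rewrite e_irr.
- by apply/setP => v; rewrite all3 inE.
- apply/setP => -[u w]; apply/idP/idP; first by rewrite inE => /edge3; rewrite all3; apply.
  by rewrite !inE -orbA => /or3P[] /eqP -> /=.
Qed.

End LineGraph.

(** * From independent sets to directed cuts *)

Lemma cut_of_indep (V : finType) (e : rel V) (I : {set V * V}) :
    irreflexive e -> I \subset edges e -> indep (line_arc e) I ->
  exists2 F, directed_cut e F & #|I| <= #|F|.
Proof.
move=> e_irr IE Ii; pose X := [set p.1 | p in I].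
exists (cut_edges e X (~: X)).
  by exists X, (~: X); split=> //; [rewrite -setI_eq0 setICr | rewrite setUCr].
apply: subset_leq_card; apply/subsetP => p pI; rewrite inE (subsetP IE) //=.
(* If the head of [p] were the tail of a member [q] of [I], the two would be adjacent in the line
   graph. *)
rewrite imset_f //= inE; apply/imsetP => -[q qI E].
have := Ii p q pI qI; rewrite line_adj.
have := subsetP IE p pI; have := subsetP IE q qI; rewrite !inE => -> -> /=.
by rewrite E eqxx orbT.
Qed.

Theorem theorem5 (V : finType) (e : rel V) (e_loopless : irreflexive e)
    (m : nat) (card_edges : #|edges e| = m)
    (D11 : in_D e 1 1) (e_connected : connected_digraph e)
    (not_triangle : ~ directed_triangle e) :
  exists2 F : {set V * V},
    directed_cut e F & ((7 * m)%:R / 20%:R <= #|F|%:R :> rat)%R.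
Proof.
have [I [IE Ii]] := admissible_bounded (line_arc_irr e_loopless)
  (line_triangle_closed e_loopless D11)
  (line_admissible e_loopless D11 e_connected not_triangle).
rewrite /weight big1 // addn0 card_edges => bI.
have [F cutF IF] := cut_of_indep e_loopless IE Ii.
have LE : low_to_high e \subset edges e by apply/subsetP => p; rewrite inE => /andP[].
have [G cutG LG] := cut_of_indep e_loopless LE (@low_to_high_indep V e).
have := narcs_line D11; rewrite card_edges => nA.
have suff_cut (H : {set V * V}) : directed_cut e H -> 7 * m <= 20 * #|H| ->
    exists2 F, directed_cut e F & ((7 * m)%:R / 20%:R <= #|F|%:R :> rat)%R.
  move=> cutH le; exists H => //.
  by rewrite Num.Theory.ler_pdivrMr ?Num.Theory.ltr0n // -GRing.natrM
    Num.Theory.ler_nat (mulnC #|H|).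
(* Inserting the arc bound gives [7 m <= 19 i + l], and both [i] and [l] are at most the size of the
   larger cut. *)
have arith i l n f g : 8 * m <= 19 * i + n -> i <= f -> l <= g -> n <= m + l ->
    7 * m <= 20 * maxn f g.
  by clear; lia.
have := arith _ _ _ _ _ bI IF LG nA; have [_|_] := leqP #|F| #|G|.
  exact: suff_cut.
exact: suff_cut.
Qed.
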